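(* Let $\phi$ be the characteristic function of a non-degenerate real random variable and let $k\ge 1$ be an integer. Then $\phi$ is Harris$(a,k)$-sum stable with scale parameter $c$ for some $a>1$ and some $c>0$ if and only if $$\phi(u)=\frac{1}{[1+\psi(u)]^{1/k}},\qquad u\in\mathbf{R},$$ where $\psi:\mathbf{R}\to\mathbf{C}$ is continuous, $\psi(0)=0$ and $\psi(u)=a\,\psi(bu)$ for all $u\in\mathbf{R}$, with $b=c=a^{-1/\alpha}$ for some $\alpha\in(0,2]$, the numbers $a$ and $k$ being the same as those in Harris$(a,k)$.
   Context: For $a>1$ and an integer $k\ge1$, the Harris$(a,k)$ law is the law of the positive-integer-valued random variable $N$ with probability generating function $P(t)=t/\{a-(a-1)t^k\}^{1/k}$ (principal branch of the root). A characteristic function $\phi$ is $N$-sum stable with scale parameter $c>0$ if $P(\phi(cu))=\phi(u)$ for all $u\in\mathbf{R}$, where $P$ is the probability generating function of $N$; equivalently, if $X,X_1,X_2,\dots$ are i.i.d. with characteristic function $\phi$ and independent of $N$, then $c(X_1+\dots+X_N)$ has the same distribution as $X$. Harris$(a,k)$-sum stable means $N$-sum stable with $N$ having the Harris$(a,k)$ law. The power $[1+\psi(u)]^{1/k}$ denotes the branch that is continuous in $u$ and equals $1$ at $u=0$. *)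

(* Defs.v *)
From HB Require Import structures.
From mathcomp Require Import all_boot all_order all_algebra.
From mathcomp Require Import all_classical all_reals all_analysis.
From mathcomp Require Import complex.

Set Implicit Arguments.
Unset Strict Implicit.
Unset Printing Implicit Defensive.

Import Order.TTheory GRing.Theory Num.Theory.
Import numFieldNormedType.Exports.

Local Open Scope classical_set_scope.
Local Open Scope ring_scope.
Local Open Scope complex_scope.

Definition expi (R : realType) (x : R) : R[i] := cos x +i* sin x.

(* The principal argument, with values in ]-pi, pi] for z != 0. *)
Definition Carg (R : realType) (z : R[i]) : R :=
  let x := acos (complex.Re z / ComplexField.Normc.normc z) in
  if 0 <= complex.Im z then x else - x.

(* The principal branch of z^(1/k). The library's k.-root is another branch:
   it never has a negative imaginary part when k > 1. *)
Definition principal_root (R : realType) (k : nat) (z : R[i]) : R[i] :=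
  (ComplexField.Normc.normc z `^ (k%:R)^-1)%:C * expi (Carg z / k%:R).

Definition Cexpectation (R : realType) (d : measure_display)
    (T : measurableType d) (P : probability T R) (Z : T -> R[i]) : R[i] :=
  (\int[P]_w complex.Re (Z w)) +i* (\int[P]_w complex.Im (Z w)).

Definition charfun (R : realType) (d : measure_display) (T : measurableType d)
    (P : probability T R) (X : {RV P >-> R}) (u : R) : R[i] :=
  Cexpectation P (fun w => expi (u * X w)).

Definition degenerate (R : realType) (d : measure_display)
    (T : measurableType d) (P : probability T R) (X : {RV P >-> R}) : Prop :=
  exists x : R, P (X @^-1` [set x]) = 1%E.

(* E[t^N], where N has law nu. *)
Definition pgf (R : realType) (nu : probability nat R) (t : R[i]) : R[i] :=
  Cexpectation nu (fun n => t ^+ n).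

Definition harris_law (R : realType) (a : R) (k : nat)
    (nu : probability nat R) : Prop :=
  nu [set 0%N] = 0%E /\
  forall t : R[i], `|t| <= 1 ->
    pgf nu t = t / principal_root k (a%:C - (a - 1)%:C * t ^+ k).

(* N-sum stability depends on N only through its law nu. *)
Definition sum_stable (R : realType) (nu : probability nat R) (c : R)
    (phi : R -> R[i]) : Prop :=
  forall u : R, pgf nu (phi (c * u)) = phi u.

(* r is the branch of f^(1/k) that is continuous on the real line and equals 1
   at 0; it is unique, and f has to be nonvanishing for the branch to be
   defined everywhere. *)
Definition continuous_root (R : realType) (k : nat) (f r : R -> R[i]) : Prop :=
  [/\ forall u, f u != 0,
      continuous (r : R -> R[i]^o),
      r 0 = 1 &
      forall u, r u ^+ k = f u].

(* Main.v *)
(* Write phi for the characteristic function.  Raising the stability equation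
   to the power k gives phi(u)^k (a - (a-1) phi(cu)^k) = phi(cu)^k, that is,
   psi(u) = a psi(cu) for psi = phi^(-k) - 1.
   Non-degeneracy enters through one criterion: since 1 - |phi(v)|^2 is the
   expectation of |e^(ivX) - phi(v)|^2, if the series of (1 - |phi(v_n)|^2)/v_n^2
   converges for some nonzero v_n tending to 0, then almost surely
   (e^(i v_n X) - phi(v_n))/v_n tends to 0, and comparing two sample points shows
   that X is almost surely constant.
   If c >= 1, stability gives |phi(u)| <= |phi(cu)| and |phi| = 1 near 0; if
   a c^2 > 1, then psi(c^n) = a^(-n) psi(1) makes the series geometric along
   v_n = c^n.  Both contradict non-degeneracy, whence alpha lies in (0, 2].
   Conversely, r(u) / r(cu) and the principal root of a - (a-1) phi(cu)^k, whose
   radicand stays in the half-plane Re >= 1, are continuous kth roots of the same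
   function and agree at 0, hence everywhere. *)
Require Import Defs.
From HB Require Import structures.
From mathcomp Require Import all_boot all_order all_algebra.
From mathcomp Require Import all_classical all_reals all_analysis.
From mathcomp Require Import measurable_realfun.
From mathcomp Require Import complex.
From mathcomp Require Import ring lra.

Set Implicit Arguments.
Unset Strict Implicit.
Unset Printing Implicit Defensive.

Import Order.TTheory GRing.Theory Num.Theory.
Import numFieldNormedType.Exports.

Local Open Scope ring_scope.
Local Open Scope complex_scope.

Local Notation normc := ComplexField.Normc.normc.

(** * Continuity of powers and of finite geometric sums *)

Section geometric_sum.
Variable K : numFieldType.

Lemma continuous_exprn n : continuous (fun z : K => z ^+ n).
Proof.
elim: n => [|n IHn] z.
  have -> : (fun z : K => z ^+ 0) = cst 1 by apply/funext => w; rewrite expr0.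
  exact: cst_continuous.
have -> : (fun z : K => z ^+ n.+1) = (fun z => z * z ^+ n).
  by apply/funext => w; rewrite exprS.
rewrite /continuous_at/=.
apply: (cvgM (@cvg_id _ (nbhs z)) (IHn z)).
Qed.

Lemma continuous_geometric n : continuous (fun z : K => \sum_(i < n) z ^+ i).
Proof.
elim: n => [|n IHn] z.
  have -> : (fun z : K => \sum_(i < 0) z ^+ i) = cst 0.
    by apply/funext => w; rewrite big_ord0.
  exact: cst_continuous.
have -> : (fun z : K => \sum_(i < n.+1) z ^+ i) =
    (fun z => \sum_(i < n) z ^+ i + z ^+ n).
  by apply/funext => w; rewrite big_ord_recr.
rewrite /continuous_at/=.
exact: (cvgD (f := fun x : K => \sum_(i < n) x ^+ i) (g := fun x : K => x ^+ n)
  (IHn z) (@continuous_exprn n z)).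
Qed.

End geometric_sum.

Lemma cvg_exprC (R : realType) (T : Type) (F : set_system T) (FF : Filter F)
    (k : nat) (f : T -> R[i]) (z : R[i]) :
  ((f : T -> R[i]^o) @ F --> (z : R[i]^o))%classic ->
  ((f t ^+ k : R[i]^o) @[t --> F] --> (z ^+ k : R[i]^o))%classic.
Proof. exact: (continuous_cvg _ (@continuous_exprn R[i] k z)). Qed.

(** * The complex plane: polar form, principal roots, continuous branches *)

Section complex_plane.
Variable R : realType.
Implicit Types (z : R[i]) (x y : R) (n k : nat).

Lemma normcE z : `|z| = (normc z)%:C.
Proof. by []. Qed.

Lemma normc_ge0 z : 0 <= normc z.
Proof. by rewrite -lecR -normcE normr_ge0. Qed.

Lemma sqr_normcE z : normc z ^+ 2 = complex.Re z ^+ 2 + complex.Im z ^+ 2.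
Proof. by case: z => x y /=; rewrite sqr_sqrtr// addr_ge0 ?sqr_ge0. Qed.

Lemma normc_gt0 z : z != 0 -> 0 < normc z.
Proof. by move=> z0; rewrite -ltcR -normcE normr_gt0. Qed.

Lemma normcX z n : normc (z ^+ n) = normc z ^+ n.
Proof. by apply: complexI; rewrite rmorphXn/= -!normcE normrX. Qed.

Lemma Re_le_normc z : complex.Re z <= normc z.
Proof.
rewrite -lecR -normcE; apply: le_trans (normc_ge_Re z).
by rewrite lecR ler_norm.
Qed.

Lemma cvg_complexP (T : Type) (F : set_system T) (FF : Filter F)
    (f : T -> R[i]) z :
  ((f : T -> R[i]^o) @ F --> (z : R[i]^o))%classic <->
  ((fun t => complex.Re (f t)) @ F --> complex.Re z)%classic /\
  ((fun t => complex.Im (f t)) @ F --> complex.Im z)%classic.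
Proof.
split=> [fz|[rez imz]].
  have abs_le (x y : R) : `|x| <= Num.sqrt (x ^+ 2 + y ^+ 2).
    by rewrite -sqrtr_sqr ler_wsqrtr// lerDl sqr_ge0.
  split; apply/cvgrPdist_lt => e e0;
  have ec : 0 < e%:C by rewrite ltcR.
  - move/cvgrPdist_lt : fz => /(_ _ ec); apply: filterS => t /=.
    rewrite normcE ltcR; apply: le_lt_trans.
    by case: (f t) z => [a b] [a' b']/=; exact: abs_le.
  - move/cvgrPdist_lt : fz => /(_ _ ec); apply: filterS => t /=.
    rewrite normcE ltcR; apply: le_lt_trans.
    case: (f t) z => [a b] [a' b']/=; rewrite [X in Num.sqrt X]addrC.
    exact: abs_le.
apply/cvgrPdist_lt => e; rewrite ltcE => /andP[/eqP ie re].
(* A positive element of [R[i]] has zero imaginary part, so [e] is real and can be halved between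
   the two coordinates. *)
have {ie} -> : e = (complex.Re e)%:C by case: e ie {re} => ? ? /= ->.
have e2 : 0 < complex.Re e / 2 by rewrite divr_gt0.
move/cvgrPdist_lt : imz => /(_ _ e2); move/cvgrPdist_lt : rez => /(_ _ e2).
apply: filterS2 => t /= h1 h2; rewrite normcE ltcR [ltRHS]splitr.
apply: le_lt_trans (ltrD h1 h2).
case: (f t) z {h1 h2} => [a b] [a' b']/=.
rewrite -[leRHS]ger0_norm ?addr_ge0// -sqrtr_sqr ler_wsqrtr// [leRHS]sqrrD.
by rewrite !real_normK ?num_real// lerD2r lerDl mulrn_wge0// mulr_ge0.
Qed.

Lemma continuous_complexP (T : topologicalType) (f : T -> R[i]) :
  continuous (f : T -> R[i]^o) <->
  continuous (fun t => complex.Re (f t)) /\ continuous (fun t => complex.Im (f t)).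
Proof.
split=> [cf|[cr ci] t]; last by apply/cvg_complexP; split; [exact: cr|exact: ci].
by split=> t; have [] := (cvg_complexP _ f (f t)).1 (cf t).
Qed.

Lemma expiD x y : expi (x + y) = expi x * expi y :> R[i].
Proof.
rewrite /expi cosD sinD; apply/eqP; rewrite eq_complex/= addrC eqxx/=.
by apply/eqP; ring.
Qed.

Lemma expiX x n : expi x ^+ n = expi (x *+ n) :> R[i].
Proof.
elim: n => [|n IHn]; first by rewrite expr0 mulr0n /expi cos0 sin0.
by rewrite exprS IHn mulrS expiD.
Qed.

(** [acos] fixes the cosine; since its values have nonnegative sine, the case split in [Carg] gives
    the sine the sign of Im z. *)
Lemma polar_form z : z != 0 -> z = (normc z)%:C * expi (Carg z).
Proof.
move=> z0; have r0 := normc_gt0 z0; have r2 := sqr_normcE z.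
set r := normc z in r0 r2 *.
have t1 : -1 <= complex.Re z / r <= 1.
  rewrite ler_pdivlMr// ler_pdivrMr// mul1r mulN1r -ler_norml.
  by rewrite -lecR; exact: normc_ge_Re.
have cE : cos (Carg z) = complex.Re z / r.
  by rewrite /Carg; case: ifP => _; rewrite ?cosN acosK// in_itv.
have sE : sin (Carg z) = complex.Im z / r.
  have sa : sin (acos (complex.Re z / r)) = `|complex.Im z| / r.
    rewrite sin_acos// -[r in RHS]gtr0_norm// -normf_div -sqrtr_sqr.
    by congr Num.sqrt; field: r2; rewrite gt_eqF.
  rewrite /Carg; case: ifPn => [i0|]; first by rewrite sa ger0_norm.
  by rewrite -ltNge => i0; rewrite sinN sa ltr0_norm// mulNr opprK.
rewrite /expi cE sE; apply/eqP; rewrite eq_complex/=.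
by apply/andP; split; apply/eqP; field; rewrite gt_eqF.
Qed.

Lemma principal_rootX k z : (0 < k)%N -> z != 0 -> principal_root k z ^+ k = z.
Proof.
move=> k0 z0; have kR : k%:R != 0 :> R by rewrite pnatr_eq0 -lt0n.
rewrite /principal_root exprMn expiX.
have -> : Carg z / k%:R *+ k = Carg z by rewrite -[LHS]mulr_natr divfK.
rewrite -rmorphXn/= -powR_mulrn ?powR_ge0// -powRrM mulVf// powRr1 ?normc_ge0//.
by rewrite -polar_form.
Qed.

Lemma principal_root_neq0 k z : (0 < k)%N -> z != 0 -> principal_root k z != 0.
Proof.
move=> k0 z0; apply: contraNneq (z0) => w0.
by rewrite -(principal_rootX k0 z0) w0 expr0n gtn_eqF.
Qed.

Lemma principal_root1 k : principal_root k 1 = 1 :> R[i].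
Proof.
rewrite /principal_root /Carg /= !expr0n/= expr1n addr0 sqrtr1 divr1 acos1 lexx.
by rewrite powR1 mul0r /expi cos0 sin0 mul1r.
Qed.

(** On the right half-plane the argument lies strictly between -pi/2 and pi/2, where [atan] inverts
    [tan]. This form shows continuity across the real axis, where the case split in [Carg]
    switches. *)
Lemma Carg_atan z : 0 < complex.Re z -> Carg z = atan (complex.Im z / complex.Re z).
Proof.
move=> x0; have z0 : z != 0 by apply: contraTneq x0 => ->; rewrite ltxx.
have r0 := normc_gt0 z0.
have := polar_form z0; set r := normc z in r0 *; set t := Carg z => zE.
have xE : complex.Re z = r * cos t by rewrite {1}zE /= mul0r subr0.
have yE : complex.Im z = r * sin t by rewrite {1}zE /= mul0r addr0.
have c0 : 0 < cos t by rewrite -(pmulr_rgt0 _ r0) -xE.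
have -> : complex.Im z / complex.Re z = tan t.
  by rewrite xE yE /tan; field; rewrite !gt_eqF.
rewrite tanK//.
have : 0 < complex.Re z / r by rewrite divr_gt0.
have h1 : -1 <= complex.Re z / r <= 1.
  rewrite ler_pdivlMr// ler_pdivrMr// mul1r mulN1r -ler_norml.
  by rewrite -lecR; exact: normc_ge_Re.
move=> p0; have acp : acos (complex.Re z / r) < pi / 2.
  rewrite ltNge; apply/negP => pa.
  suff : cos (acos (complex.Re z / r)) <= cos (pi / 2).
    by rewrite acosK ?in_itv// cos_pihalf leNgt p0.
  rewrite leNgt ltr_cos -?leNgt// in_itv/=.
    by rewrite acos_ge0 ?acos_lepi.
  have := pi_gt0 R; lra.
have := acos_ge0 h1; have := pi_gt0 R.
rewrite /t /Carg -/r in_itv/=; case: ifP => _ *; lra.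
Qed.

Lemma cvg_normc (T : Type) (F : set_system T) (FF : Filter F)
    (f : T -> R[i]) z : ((f : T -> R[i]^o) @ F --> (z : R[i]^o))%classic ->
  (normc (f t) @[t --> F] --> normc z)%classic.
Proof.
move=> /cvg_complexP[fre fim].
have nE (w : R[i]) :
    normc w = Num.sqrt (complex.Re w ^+ 2 + complex.Im w ^+ 2) by case: w.
rewrite nE; under eq_fun do [rewrite nE].
apply: (continuous_cvg _ (@sqrt_continuous _ _)).
by apply: cvgD; apply: cvgM.
Qed.

(** The half-plane Re > 0 avoids the branch cut, so modulus and argument both converge; they are
    replaced near the limit by their [expR]/[ln] and [atan] forms. *)
Lemma cvg_principal_root k (T : Type) (F : set_system T) (FF : Filter F)
    (f : T -> R[i]) z : 0 < complex.Re z ->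
  ((f : T -> R[i]^o) @ F --> (z : R[i]^o))%classic ->
  ((principal_root k (f t) : R[i]^o) @[t --> F] -->
    (principal_root k z : R[i]^o))%classic.
Proof.
move=> x0; have z0 : z != 0 by apply: contraTneq x0 => ->; rewrite ltxx.
move=> fz; have fnorm := cvg_normc FF fz.
have [fre fim] := (cvg_complexP FF f z).1 fz.
have cn : (normc (f t) `^ k%:R^-1 @[t --> F] --> normc z `^ k%:R^-1)%classic.
  (* [powR] takes a separate value at base 0, so this formula holds only off 0, that is, eventually
     along [F]. *)
  have pE (w : R[i]) : w != 0 -> normc w `^ k%:R^-1 = expR (k%:R^-1 * ln (normc w)).
    by move=> w0; rewrite /powR (gt_eqF (normc_gt0 w0)).
  rewrite pE//.
  have : (expR (k%:R^-1 * ln (normc (f t))) @[t --> F] -->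
      expR (k%:R^-1 * ln (normc z)))%classic.
    apply: (continuous_cvg _ (@continuous_expR _ _)).
    apply: cvgM; first exact: cvg_cst.
    exact: (continuous_cvg _ (continuous_ln (normc_gt0 z0))).
  apply: cvg_trans; apply: near_eq_cvg; near=> t.
  rewrite pE//; have : 0 < complex.Re (f t).
    by near: t; exact: (cvgr_gt (complex.Re z) fre _ x0).
  by apply: contraTneq => ->; rewrite ltxx.
have ca : (Carg (f t) / k%:R @[t --> F] --> Carg z / k%:R)%classic.
  rewrite (Carg_atan x0).
  have : (atan (complex.Im (f t) / complex.Re (f t)) / k%:R @[t --> F] -->
      atan (complex.Im z / complex.Re z) / k%:R)%classic.
    apply: cvgM; last exact: cvg_cst.
    apply: (continuous_cvg _ (@continuous_atan _ _)).
    by apply: cvgM => //; apply: cvgV => //; rewrite gt_eqF.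
  apply: cvg_trans; apply: near_eq_cvg; near=> t.
  by rewrite Carg_atan//; near: t; exact: (cvgr_gt (complex.Re z) fre _ x0).
have cc := continuous_cvg FF (@continuous_cos _ _) ca.
have cs := continuous_cvg FF (@continuous_sin _ _) ca.
apply/cvg_complexP; split; rewrite /principal_root /=.
  by under eq_fun do [rewrite mul0r subr0]; rewrite mul0r subr0; exact: (cvgM cn cc).
by under eq_fun do [rewrite mul0r addr0]; rewrite mul0r addr0; exact: (cvgM cn cs).
Unshelve. all: by end_near.
Qed.

(* The kth roots of unity form a discrete set and the line is connected. *)
Lemma continuous_unity_root k (q : R -> R[i]) : (0 < k)%N ->
  continuous (q : R -> R[i]^o) -> (forall u, q u ^+ k = 1) -> q 0 = 1 ->
  forall u, q u = 1.
Proof.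
move=> k0 cq qk q0.
pose A : set R := [set u | q u = 1]%classic.
suff AT : (A = setT)%classic by move=> u; have : A u by rewrite AT.
have cl : closed A.
  apply: (preimage_closed (f := q : R -> R[i]^o) (D := [set (1 : R[i]^o)]%classic)).
    by move=> u _; exact: cq.
  exact/accessible_closed_set1/hausdorff_accessible/norm_hausdorff.
(* z^k - 1 = (z - 1) s(z) with s(1) = k nonzero: near a point of [A] the factor s(q) does not
   vanish, which forces q = 1 there. *)
pose s z := \sum_(i < k) z ^+ i.
have cs : continuous (s : R[i]^o -> R[i]^o) by exact: (@continuous_geometric R[i]).
have s1 : s 1 != 0.
  rewrite /s; under eq_bigr do rewrite expr1n.
  by rewrite sumr_const card_ord pnatr_eq0 -lt0n.
have op : open A.
  rewrite openE => u; rewrite /A/= => qu.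
  have : ((s \o q) v @[v --> u] --> (s 1 : R[i]^o))%classic.
    rewrite -qu; apply: (continuous_cvg (h := s : R[i]^o -> R[i]^o) _ (cs _)).
    exact: cq.
  move/(@cvgr_neq0 _ R[i]^o)/(_ s1); apply: filterS => v /= sv.
  have : q v ^+ k - 1 = 0 by rewrite qk subrr.
  rewrite subrX1 => /eqP; rewrite mulf_eq0 (negbTE sv) orbF subr_eq0.
  by move/eqP.
have /connected_intervalP/(_ A) : is_interval [set: R]%classic by [].
by apply; [exists 0|exists A; rewrite ?setTI|exists A; rewrite ?setTI].
Qed.

End complex_plane.

(** For x > 0 the mean value theorem gives sin x = x cos c with 0 < c < x <= 1, and the cosine
    decreases on [0, pi]. *)
Lemma cos1_norm_le_sin (R : realType) (x : R) :
  `|x| <= 1 -> cos 1 * `|x| <= `|sin x|.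
Proof.
wlog x0 : x / 0 < x => [hw|].
  have [->|xn0] := eqVneq x 0; first by rewrite normr0 mulr0.
  case: (ltgtP x 0) xn0 => // xlt _; last exact: hw.
  by have := hw (- x); rewrite oppr_gt0 sinN !normrN; exact.
rewrite gtr0_norm// => x1.
have [c] := @MVT_segment R sin cos 0 x (ltW x0) (fun y _ => is_derive_sin y)
  (continuous_subspaceT (@continuous_sin R)).
rewrite in_itv/= sin0 !subr0 => /andP[c0 cx] ->.
rewrite (le_trans _ (ler_norm _))//; apply: ler_wpM2r; first exact: ltW.
have pi2 := pi_ge2 R.
rewrite leNgt ltr_cos ?in_itv/=; first by rewrite -leNgt (le_trans cx).
  by apply/andP; split; lra.
by apply/andP; split; lra.
Qed.

(** * Characteristic functions and the degeneracy criterion *)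

Section characteristic_function.
Variables (R : realType) (d : measure_display) (T : measurableType d).
Variables (P : probability T R) (X : {RV P >-> R}).

Lemma integrable_bounded_rv (M : R) (f : T -> R) :
  measurable_fun setT f -> (forall w, `|f w| <= M) ->
  P.-integrable setT (EFin \o f).
Proof.
move=> mf fM; apply: measurable_bounded_integrable => //.
  by rewrite (le_lt_trans (probability_le1 P _))// ltry.
exists M; split; first exact: num_real.
by move=> y My w _ /=; rewrite (le_trans (fM w))// ltW.
Qed.

Lemma measurable_cos_rv u : measurable_fun setT (fun w => cos (u * X w)).
Proof.
apply: (measurableT_comp (f := cos)).
  by apply: continuous_measurable_fun; exact: continuous_cos.
by apply: measurable_funM => //; exact: measurable_cst.
Qed.

Lemma measurable_sin_rv u : measurable_fun setT (fun w => sin (u * X w)).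
Proof.
apply: (measurableT_comp (f := sin)).
  by apply: continuous_measurable_fun; exact: continuous_sin.
by apply: measurable_funM => //; exact: measurable_cst.
Qed.

Lemma integrable_cos_rv u : P.-integrable setT (EFin \o (fun w => cos (u * X w))).
Proof.
apply: (@integrable_bounded_rv 1); first exact: measurable_cos_rv.
by move=> w; exact: cos_max.
Qed.

Lemma integrable_sin_rv u : P.-integrable setT (EFin \o (fun w => sin (u * X w))).
Proof.
apply: (@integrable_bounded_rv 1); first exact: measurable_sin_rv.
by move=> w; exact: sin_max.
Qed.

Lemma integrable_cst_rv (r : R) : P.-integrable setT (EFin \o (fun _ : T => r)).
Proof. exact: (@integrable_bounded_rv `|r|). Qed.

Lemma Rintegral_cst_probability (r : R) : (\int[P]_w r)%R = r.
Proof.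
rewrite Rintegral_cst//; have PT : P setT = 1%E := probability_setT P.
by rewrite [X in fine X]PT mulr1.
Qed.

Let gap u w := (cos (u * X w) - complex.Re (charfun X u)) ^+ 2 +
               (sin (u * X w) - complex.Im (charfun X u)) ^+ 2.

Let gap_ge0 u w : 0 <= gap u w.
Proof. by rewrite addr_ge0 ?sqr_ge0. Qed.

Let gapE u w : gap u w = 1 + normc (charfun X u) ^+ 2 -
  2 * complex.Re (charfun X u) * cos (u * X w) -
  2 * complex.Im (charfun X u) * sin (u * X w).
Proof. by have := cos2Dsin2 (u * X w); rewrite sqr_normcE /gap; lra. Qed.

Let measurable_gap u : measurable_fun setT (gap u).
Proof.
by apply: measurable_funD; apply: (measurable_funX 2); apply: measurable_funB;
  [exact: measurable_cos_rv|exact: measurable_cst|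
   exact: measurable_sin_rv|exact: measurable_cst].
Qed.

(** Variance identity E|Z - EZ|^2 = E|Z|^2 - |EZ|^2 for Z = e^(iuX), where |Z| = 1. *)
Let expectation_gap u :
  (\int[P]_w gap u w)%R = 1 - normc (charfun X u) ^+ 2.
Proof.
under eq_Rintegral do rewrite gapE.
have Zint r f : P.-integrable setT (EFin \o f) ->
    P.-integrable setT (EFin \o (fun w => r * f w)).
  by move=> fi; apply: (integrableZl _ r) fi.
have ci := Zint (2 * complex.Re (charfun X u)) _ (integrable_cos_rv u).
have si := Zint (2 * complex.Im (charfun X u)) _ (integrable_sin_rv u).
have ki := integrable_cst_rv (1 + normc (charfun X u) ^+ 2).
rewrite RintegralB//; last exact: (integrableB _ ki ci).
rewrite RintegralB// !RintegralZl//;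
  [|exact: integrable_sin_rv|exact: integrable_cos_rv].
rewrite Rintegral_cst_probability.
rewrite -[(\int[P]_w cos _)%R]/(complex.Re (charfun X u)).
rewrite -[(\int[P]_w sin _)%R]/(complex.Im (charfun X u)).
by rewrite sqr_normcE; ring.
Qed.

Lemma charfun0 : charfun X 0 = 1.
Proof.
rewrite /charfun /Cexpectation.
under eq_Rintegral do rewrite mul0r /= cos0.
under [X in _ +i* X]eq_Rintegral do rewrite mul0r /= sin0.
by rewrite !Rintegral_cst_probability.
Qed.

Lemma normc_charfun_le1 u : normc (charfun X u) <= 1.
Proof.
have : 0 <= 1 - normc (charfun X u) ^+ 2.
  by rewrite -expectation_gap; apply: Rintegral_ge0 => w _; exact: gap_ge0.
by rewrite subr_ge0 expr_le1// normc_ge0.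
Qed.

Lemma continuous_charfun : continuous (charfun X : R -> R[i]^o).
Proof.
have ci (g : R -> R) : continuous g -> (forall x, `|g x| <= 1) ->
    continuous (fun u : R => \int[P]_w g (u * X w))%R.
  (* Dominated convergence with the constant bound 1; the interval around [u] only localizes the
     parameter. *)
  move=> cg g1 u; apply: (@continuity_under_integral _ _ _ P
      (fun u w => g (u * X w)) setT _ (u - 1) (u + 1) _ _ (fun=> 1)) => //.
  - move=> x _; apply: (@integrable_bounded_rv 1) => //.
    apply: (measurableT_comp (f := g)); first exact: continuous_measurable_fun.
    by apply: measurable_funM => //; exact: measurable_cst.
  - apply: aeW => w _ x _; apply: (continuous_cvg _ (cg _)).
    by apply: cvgM; [exact: cvg_id|exact: cvg_cst].
  - exact: integrable_cst_rv.
  - by move=> x _; apply: aeW.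
  - by rewrite inE/= in_itv/=; apply/andP; split; lra.
apply/continuous_complexP; split.
  exact: (ci _ (@continuous_cos R) (@cos_max R)).
exact: (ci _ (@continuous_sin R) (@sin_max R)).
Qed.

(* [gap u w] is |e^(i u X(w)) - phi(u)|^2, with expectation 1 - |phi(u)|^2;
   the triangle inequality through phi(u) compares two points. *)
Let gap_separates u w w' : `|u * (X w - X w')| <= 2 ->
  cos 1 ^+ 2 * (u * (X w - X w')) ^+ 2 <= 4 * (gap u w + gap u w').
Proof.
move=> le2; set h := u * (X w - X w') / 2.
have h1 : `|h| <= 1
  by move: le2; rewrite /h !ler_norml => /andP[? ?]; apply/andP; split; lra.
have -> : (u * (X w - X w')) ^+ 2 = 4 * h ^+ 2 by rewrite /h; field.
have := cos1_norm_le_sin h1; have c1 := cos1_gt0 R => ch.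
have ch2 : cos 1 ^+ 2 * h ^+ 2 <= sin h ^+ 2.
  rewrite -(real_normK (num_real h)) -(real_normK (num_real (sin h))) -exprMn.
  by rewrite ler_pXn2r ?nnegrE ?mulr_ge0// ltW.
(* Twice either side is the squared distance between e^(iuX(w)) and e^(iuX(w')); [h] is the
   half-angle. *)
have sE : 2 * sin h ^+ 2 = 1 - cos (u * X w) * cos (u * X w')
    - sin (u * X w) * sin (u * X w').
  have -> : 1 - cos (u * X w) * cos (u * X w') - sin (u * X w) * sin (u * X w')
     = 1 - cos (u * X w - u * X w') by rewrite cosB; ring.
  have -> : u * X w - u * X w' = h *+ 2 by rewrite -mulr_natr /h; field.
  by rewrite cos_mulr2n cos2sin2; ring.
have {}ch2 : cos 1 ^+ 2 * (4 * h ^+ 2) <= 2 * (2 * sin h ^+ 2) by lra.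
rewrite (le_trans ch2)// sE /gap.
have c2 := cos2Dsin2 (u * X w); have c2' := cos2Dsin2 (u * X w').
(* With p, p' the two points on the unit circle, these squares add up to |p + p' - 2 phi(u)|^2, and
   the parallelogram law bounds |p - p'|^2 by twice the sum of the gaps. *)
have q1 := sqr_ge0 (cos (u * X w) + cos (u * X w') - 2 * complex.Re (charfun X u)).
have q2 := sqr_ge0 (sin (u * X w) + sin (u * X w') - 2 * complex.Im (charfun X u)).
nra.
Qed.

(** By monotone convergence the given series is the expectation of the sum [F] of the normalized
    gaps. Hence [F] is finite almost surely, the gaps there are o(v_n^2), and [gap_separates]
    identifies the values of X at any two such points. *)
Lemma charfun_degenerate (v : nat -> R) : (forall n, v n != 0) ->
  (v @ \oo --> 0)%classic ->
  (\sum_(0 <= n <oo) ((1 - normc (charfun X (v n)) ^+ 2) / v n ^+ 2)%:E < +oo)%E ->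
  degenerate X.
Proof.
move=> v0 vto0 sumfin.
pose f n w := gap (v n) w / v n ^+ 2.
have f0 n w : 0 <= f n w by rewrite divr_ge0// sqr_ge0.
have mf n : measurable_fun setT (EFin \o f n).
  apply/measurable_EFinP; apply: measurable_funM; first exact: measurable_gap.
  exact: measurable_cst.
have intf n : (\int[P]_w (f n w)%:E)%E =
    ((1 - normc (charfun X (v n)) ^+ 2) / v n ^+ 2)%:E.
  rewrite -expectation_gap.
  have gi : P.-integrable setT (EFin \o gap (v n)).
    (* A crude bound: two points of the closed unit disc are at squared distance at most 4. *)
    apply: (@integrable_bounded_rv 8); first exact: measurable_gap.
    move=> w; rewrite ger0_norm// /gap.
    have := normc_charfun_le1 (v n); have := sqr_normcE (charfun X (v n)).
    have := normc_ge0 (charfun X (v n)); have := cos2Dsin2 (v n * X w).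
    have q1 := sqr_ge0 (cos (v n * X w) + complex.Re (charfun X (v n))).
    have q2 := sqr_ge0 (sin (v n * X w) + complex.Im (charfun X (v n))).
    nra.
  rewrite mulrC EFinM /Rintegral fineK; last exact: integrable_fin_num.
  by rewrite -integralZl//; apply: eq_integral => w _; rewrite /f mulrC EFinM.
pose F w := (\sum_(0 <= n <oo) (f n w)%:E)%E.
have F0 w : (0 <= F w)%E by apply: nneseries_ge0 => n _ _; rewrite lee_fin.
have mF : measurable_fun setT F.
  apply: (@ge0_emeasurable_sum _ _ _ setT (fun n => EFin \o f n) predT) => //.
  by move=> n w _ _; rewrite lee_fin.
have intF : P.-integrable setT F.
  apply/integrableP; split=> //.
  under eq_integral do rewrite gee0_abs//.
  rewrite integral_nneseries//; last by move=> n w _; rewrite lee_fin.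
  by under eq_eseriesr do rewrite intf.
have finF := integrable_ae measurableT intF.
have f_cvg0 w : F w \is a fin_num -> (f ^~ w @ \oo --> 0)%classic.
  move=> Fw; apply: cvg_series_cvg_0; apply: nondecreasing_is_cvgn.
    by apply/nondecreasing_series => n _ _.
  exists (fine (F w)) => _ [n _ <-]; rewrite -lee_fin fineK// /series/= -sumEFin.
  by apply: nneseries_lim_ge => m _; rewrite lee_fin.
have same w w' : F w \is a fin_num -> F w' \is a fin_num -> X w = X w'.
  move=> /f_cvg0 fw /f_cvg0 fw'; set t := X w - X w'.
  suff : cos 1 ^+ 2 * t ^+ 2 <= 4 * (0 + 0).
    have := sqr_ge0 t; have c1 : 0 < cos 1 ^+ 2 :> R by rewrite exprn_gt0// cos1_gt0.
    rewrite addr0 mulr0 pmulr_rle0// => t0 t0'.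
    by apply/eqP; rewrite -subr_eq0 -/t -(sqrf_eq0) eq_le t0 t0'.
  (* Once |v_n t| <= 2, [gap_separates] divided by v_n^2 bounds (cos 1)^2 t^2 by this null
     sequence. *)
  have cv : ((4 * (f n w + f n w') : R) @[n --> \oo] --> (4 * (0 + 0) : R))%classic.
    by apply: cvgM; [exact: cvg_cst|exact: cvgD].
  apply: (ler_cvg_to (cvg_cst _) cv).
  have vt0 : (v n * t @[n --> \oo] --> 0 * t)%classic.
    by apply: cvgM; [exact: vto0|exact: cvg_cst].
  rewrite mul0r in vt0; move/cvgr0Pnorm_le : vt0 => /(_ 2 (ltr0Sn _ _)).
  apply: filterS => n /gap_separates le_gap.
  rewrite /f -mulrDl mulrA ler_pdivlMr; last first.
    by rewrite lt_def sqr_ge0 sqrf_eq0 v0.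
  by rewrite -mulrA -exprMn [t * _]mulrC.
have [A [mA PA0 subA]] := finF.
have PAC : P (~` A)%classic = 1%E by rewrite probability_setC// PA0 sube0.
have finAC w : ~ A w -> F w \is a fin_num.
  move=> nAw; apply: contrapT => nF; apply/nAw/subA => /=.
  by apply/contra_not: nF; exact.
(* The complement of the null set has mass 1, hence a point, and X is constant on it. *)
have [w0 Aw0] : exists w, ~ A w.
  apply: contrapT => /forallNP/= noA; suff : P setT = 0%E.
    by rewrite probability_setT => /eqP; rewrite eqe oner_eq0.
  by rewrite -PA0; congr (P _); apply/seteqP; split=> // w _; exact: contrapT.
have mX : measurable (X @^-1` [set X w0])%classic.
  rewrite -[X in measurable X]setTI; exact: (measurable_funP X).
exists (X w0); apply/eqP; rewrite eq_le probability_le1//= -PAC.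
apply: le_measure; rewrite ?inE//; first exact: measurableC.
by move=> w Aw /=; apply: same; exact: finAC.
Qed.

End characteristic_function.

(** * The Harris law and consequences of stability *)

Definition harris_radicand (R : realType) (a : R) (k : nat) (t : R[i]) : R[i] :=
  a%:C - (a - 1)%:C * t ^+ k.

Section harris.
Variables (R : realType) (a : R) (k : nat).
Hypotheses (a1 : 1 < a) (k0 : (0 < k)%N).

(** The real part is 1 + (a - 1)(1 - Re t^k). The bound keeps the radicand nonzero, off the branch
    cut and of modulus at least 1. *)
Lemma harris_Re_ge1 (t : R[i]) : normc t <= 1 ->
  1 <= complex.Re (harris_radicand a k t).
Proof.
rewrite /harris_radicand => t1; have : complex.Re (t ^+ k) <= 1.
  by rewrite (le_trans (Re_le_normc _))// normcX exprn_ile1// normc_ge0.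
case: (t ^+ k) => x y /= x1; rewrite mul0r subr0.
have : 0 <= (a - 1) * (1 - x) by rewrite mulr_ge0// subr_ge0// ltW.
lra.
Qed.

Lemma harris_neq0 (t : R[i]) : normc t <= 1 ->
  harris_radicand a k t != 0.
Proof.
by move=> /harris_Re_ge1; apply: contraTneq => ->; rewrite /= ler10.
Qed.

Lemma harris_root_ge1 (t : R[i]) : normc t <= 1 ->
  1 <= normc (principal_root k (harris_radicand a k t)).
Proof.
move=> t1; rewrite -(expr_ge1 (n := k))// ?normc_ge0//.
rewrite -normcX principal_rootX ?harris_neq0//.
by rewrite (le_trans (harris_Re_ge1 t1))// Re_le_normc.
Qed.

Variables (nu : probability nat R) (c : R) (phi : R -> R[i]).
Hypotheses (hnu : harris_law a k nu) (phi_le1 : forall u, normc (phi u) <= 1).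

Lemma harris_sum_stableP : sum_stable nu c phi <->
  forall u, phi u =
    phi (c * u) / principal_root k (harris_radicand a k (phi (c * u))).
Proof.
have pE u : pgf nu (phi u) = phi u / principal_root k (harris_radicand a k (phi u)).
  by apply: hnu.2; have := phi_le1 u; rewrite -lecR.
by split=> h u; [rewrite -[LHS](h u) pE|rewrite pE -h].
Qed.

Hypotheses (c_gt0 : 0 < c) (stable : sum_stable nu c phi).

Lemma harris_stable_exprk u :
  phi u ^+ k * harris_radicand a k (phi (c * u)) = phi (c * u) ^+ k.
Proof.
rewrite {1}(harris_sum_stableP.1 stable u) expr_div_n.
by rewrite principal_rootX ?harris_neq0// divfK// harris_neq0.
Qed.

(** Stability divides phi(cu) by a root of modulus at least 1. *)
Lemma harris_stable_le u : normc (phi u) <= normc (phi (c * u)).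
Proof.
have w1 := harris_root_ge1 (phi_le1 (c * u)).
rewrite (harris_sum_stableP.1 stable u) ComplexField.Normc.normcM.
rewrite ComplexField.Normc.normcV ler_pdivrMr ?(lt_le_trans ltr01)//.
by rewrite ler_peMr// normc_ge0.
Qed.

Hypotheses (phi0 : phi 0 = 1) (cphi : continuous (phi : R -> R[i]^o)).

Lemma continuous_normc_phi : continuous (fun u => normc (phi u)).
Proof.
by move=> u; apply: cvg_normc; exact: cphi.
Qed.

Lemma cvg_normc_phi0 (v : nat -> R) : (v @ \oo --> 0)%classic ->
  (normc (phi (v n)) @[n --> \oo] --> (1 : R))%classic.
Proof.
move=> vc; have -> : (1 : R) = normc (phi 0).
  by rewrite phi0 ComplexField.Normc.normc1.
exact: (continuous_cvg _ (@continuous_normc_phi 0)).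
Qed.

(** A zero at u propagates to every c^n u; these tend to 0, where phi is continuous with value 1. *)
Lemma harris_stable_neq0 (c1 : c < 1) u : phi u != 0.
Proof.
apply/negP => /eqP pu.
have p0 n : phi (c ^+ n * u) = 0.
  elim: n => [|n IHn]; first by rewrite mul1r.
  have := harris_stable_exprk (c ^+ n * u).
  rewrite IHn expr0n gtn_eqF// mul0r mulrA -exprS => /esym/eqP.
  by rewrite expf_eq0 k0 => /eqP.
have cn : (c ^+ n * u @[n --> \oo] --> (0 : R))%classic.
  rewrite -(mul0r u); apply: cvgM; last exact: cvg_cst.
  by apply: cvg_expr; rewrite gtr0_norm.
have := cvg_normc_phi0 cn.
under eq_fun do [rewrite p0 ComplexField.Normc.normc0].
move=> /(cvg_unique (@norm_hausdorff _ _) (cvg_cst _))/eqP.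
by rewrite eq_sym oner_eq0.
Qed.

(** If c = 1, cancelling phi(u)^k, nonzero near 0, leaves radicand 1, so phi(u)^k = 1. If c > 1,
    [harris_stable_le] iterated along c^(-n) u, which tends to 0, gives 1 <= |phi(u)| for every
    u. *)
Lemma harris_stable_norm1 : 1 <= c -> \forall u \near 0, normc (phi u) = 1.
Proof.
rewrite le_eqVlt => /predU1P[c1|c1].
  have : \forall u \near 0, normc (phi u) != 0.
    apply: cvgr_neq0 (@continuous_normc_phi 0) _.
    by rewrite phi0 ComplexField.Normc.normc1 oner_eq0.
  apply: filterS => u pu0; have pu : phi u ^+ k != 0.
    rewrite expf_neq0//; apply: contraNneq pu0 => ->.
    by rewrite ComplexField.Normc.normc0.
  have := harris_stable_exprk u; rewrite -c1 mul1r -[RHS]mulr1 => /(mulfI pu).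
  move/eqP; rewrite -subr_eq0 {1}/harris_radicand.
  have -> : a%:C - (a - 1)%:C * phi u ^+ k - 1 = (a - 1)%:C * (1 - phi u ^+ k).
    by rewrite rmorphB rmorph1/=; ring.
  rewrite mulf_eq0 -(rmorph0 (real_complex R)) (inj_eq (@complexI _)).
  rewrite gt_eqF ?subr_gt0//= rmorph0 subr_eq0 => /eqP pk.
  have := normcX (phi u) k; rewrite -pk ComplexField.Normc.normc1 => /esym/eqP.
  by rewrite pexpr_eq1 ?normc_ge0// => /eqP.
apply: filterE => u; apply/eqP; rewrite eq_le phi_le1/=.
have cV0 : 0 < c^-1 by rewrite invr_gt0.
have le n : normc (phi (c^-1 ^+ n * u)) <= normc (phi u).
  elim: n => [|n IHn]; first by rewrite mul1r.
  rewrite (le_trans _ IHn)// (le_trans (harris_stable_le _))//.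
  by rewrite exprS !mulrA mulfV ?mul1r// gt_eqF.
have cn : (c^-1 ^+ n * u @[n --> \oo] --> (0 : R))%classic.
  rewrite -(mul0r u); apply: cvgM; last exact: cvg_cst.
  by apply: cvg_expr; rewrite gtr0_norm// invf_lt1.
by apply: (ler_cvg_to (cvg_normc_phi0 cn) (cvg_cst _)); exact: nearW.
Qed.

End harris.

(** * Two situations that force degeneracy *)

Section normalization.
Variables (R : realType) (d : measure_display) (T : measurableType d).
Variables (P : probability T R) (X : {RV P >-> R}).

Lemma charfun_unit_degenerate :
  (\forall u \near 0, normc (charfun X u) = 1) -> degenerate X.
Proof.
move=> /nbhs_ballP[e /= e0 ball1].
have He u : ball 0 e u -> normc (charfun X u) = 1 := ball1 u.
(* [harmonic n] is 1/(n+1), at most 1, so every v_n stays in the ball and every term of the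
   criterion's series is 0. *)
pose v n := e / 2 * harmonic n.
have hn (n : nat) : 0 < harmonic n :> R by rewrite /harmonic/= invr_gt0.
have v0 n : 0 < v n by rewrite mulr_gt0// divr_gt0.
apply: (@charfun_degenerate _ _ _ _ _ v).
- by move=> n; rewrite gt_eqF.
- rewrite -(mulr0 (e / 2)); apply: cvgM; first exact: cvg_cst.
  exact: cvg_harmonic.
- rewrite eseries0 ?ltry// => n _ _; rewrite He ?expr1n ?subrr ?mul0r//.
  rewrite /ball/= sub0r normrN gtr0_norm//.
  rewrite (@le_lt_trans _ _ (e / 2))//; last first.
    by rewrite ltr_pdivrMr// ltr_pMr// ltr1n.
  have h1 : harmonic n <= 1 :> R by rewrite /harmonic/= invf_le1// ler1n.
  by apply: ler_piMr h1; rewrite divr_ge0// ltW.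
Qed.

(* The hypothesis says that |phi(v)|^2 = 1 - o(v^2) at a geometric rate along
   v = c^n, which excludes any exponent alpha > 2. *)
Lemma charfun_geometric_degenerate (c rho K : R) : 0 < c < 1 -> 0 < rho < 1 ->
  0 <= K ->
  (forall n, 1 - normc (charfun X (c ^+ n)) ^+ 2 <= K * (c ^+ 2 * rho) ^+ n) ->
  degenerate X.
Proof.
move=> /andP[c0 c1] /andP[r0 r1] K0 hK.
apply: (@charfun_degenerate _ _ _ _ _ (fun n => c ^+ n)).
- by move=> n; rewrite expf_neq0// gt_eqF.
- by apply: cvg_expr; rewrite gtr0_norm.
(* Division by c^(2n) leaves terms at most K rho^n, whose geometric sum is K/(1 - rho). *)
apply: (@le_lt_trans _ _ (K / (1 - rho))%:E); last exact: ltry.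
have q0 n : 0 <= (1 - normc (charfun X (c ^+ n)) ^+ 2) / c ^+ n ^+ 2.
  rewrite divr_ge0 ?sqr_ge0// subr_ge0 expr_le1// ?normc_charfun_le1//.
  exact: normc_ge0.
apply: lime_le; first by apply: is_cvg_nneseries => n _ _; rewrite lee_fin.
apply: nearW => n; rewrite sumEFin lee_fin.
have r1' : `|rho| < 1 by rewrite gtr0_norm.
apply: le_trans (geometric_le_lim n K0 r0 r1').
apply: ler_sum => i _; rewrite /geometric/= ler_pdivrMr ?exprn_gt0//.
by rewrite (le_trans (hK i))// exprMn -exprM mulnC exprM [X in K * X]mulrC mulrA.
Qed.

End normalization.

(** With s = |z|, the triangle inequality gives 1 - s^k <= |p| s^k <= |p|; moreover s^k <= s, and 1
    - s^2 = 2(1 - s) - (1 - s)^2. This turns decay of psi into decay of 1 - |phi|^2. *)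
Lemma one_minus_sqr_normc_le (R : realType) (k : nat) (z p : R[i]) : (0 < k)%N ->
  z != 0 -> normc z <= 1 -> z ^- k = 1 + p -> 1 - normc z ^+ 2 <= 2 * normc p.
Proof.
move=> k0 z0 z1 zp; set s := normc z in z1 *.
have s0 : 0 < s := normc_gt0 z0.
have sk0 : 0 < s ^+ k by rewrite exprn_gt0.
have p0 := normc_ge0 p.
have : (s ^+ k)^-1 <= 1 + normc p.
  rewrite -normcX -ComplexField.Normc.normcV zp.
  by rewrite (le_trans (le_normcD _ _))// ComplexField.Normc.normc1.
rewrite -[X in X <= _]div1r ler_pdivrMr// => h.
have sk1 : s ^+ k <= s by rewrite -[X in _ <= X]expr1 ler_wiXn2l// ltW.
have sk2 : s ^+ k <= 1 by rewrite (le_trans sk1).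
have : normc p * s ^+ k <= normc p by rewrite ler_piMr.
have : 0 <= (1 - s) * (1 - s) by rewrite -expr2 sqr_ge0.
lra.
Qed.

(** * Both directions of the characterization *)

Theorem theorem2p1 (R : realType) (d : measure_display) (T : measurableType d)
    (P : probability T R) (X : {RV P >-> R}) (hX : ~ degenerate X)
    (k : nat) (hk : (1 <= k)%N) (a c : R) (ha : 1 < a) (hc : 0 < c)
    (nu : probability nat R) (hnu : harris_law a k nu) :
  sum_stable nu c (charfun X) <->
  exists (psi : R -> R[i]) (b alpha : R),
    [/\ continuous (psi : R -> R[i]^o),
        psi 0 = 0 &
        forall u, psi u = a%:C * psi (b * u)] /\
    [/\ 0 < alpha <= 2, b = c & c = a `^ (- alpha^-1)] /\
    exists2 r : R -> R[i],
      continuous_root k (fun u => 1 + psi u) r &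
      forall u, charfun X u = 1 / r u.
Proof.
have phi_le1 := normc_charfun_le1 X.
have cphi := @continuous_charfun R d T P X.
have phi0 := charfun0 X.
have a0 : 0 < a := lt_trans ltr01 ha.
split=> [stable|[psi [b [alpha [[_ _ psiE] [[_ bc _] [r [psi1 cr r0 rk] phiE]]]]]]].
- have c1 : c < 1.
    rewrite ltNge; apply/negP => c1; apply: hX; apply: charfun_unit_degenerate.
    exact: (harris_stable_norm1 ha hk hnu phi_le1 hc stable phi0 cphi c1).
  have phiN0 := harris_stable_neq0 ha hk hnu phi_le1 hc stable phi0 cphi c1.
  pose psi u := charfun X u ^- k - 1.
  have psiE u : psi u = a%:C * psi (c * u).
    have := harris_stable_exprk ha hk hnu phi_le1 stable u.
    have pu : charfun X u ^+ k != 0 by rewrite expf_neq0.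
    have pcu : charfun X (c * u) ^+ k != 0 by rewrite expf_neq0.
    rewrite /psi /harris_radicand; move: pu pcu; rewrite rmorphB rmorph1.
    move: (charfun X u ^+ k) (charfun X (c * u) ^+ k) => x y x0 y0 h.
    (* Over the common denominator xy, the goal 1/x - 1 = a(1/y - 1) is the stability identity [h]
       rearranged. *)
    have E : y - x * y = a%:C * x - a%:C * x * y by rewrite -[X in X - _]h; ring.
    have -> : x^-1 - 1 = (y - x * y) / (x * y) by field; rewrite ?x0 ?y0.
    by rewrite E; field; rewrite ?x0 ?y0.
  have ac2 : a * c ^+ 2 <= 1.
    rewrite leNgt; apply/negP => ac2; apply: hX.
    (* The ratio rho = 1/(a c^2) is chosen so that c^2 rho = 1/a, the rate at which psi(c^n)
       decays. *)
    have rho0 : 0 < (a * c ^+ 2)^-1 < 1.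
      by rewrite invr_gt0 invf_lt1 ?(lt_trans ltr01 ac2)//.
    apply: (@charfun_geometric_degenerate _ _ _ _ _ c _ (2 * normc (psi 1)) _ rho0).
    + by rewrite hc.
    + by rewrite mulr_ge0// normc_ge0.
    move=> n; have psin : normc (psi (c ^+ n)) = normc (psi 1) * a^-1 ^+ n.
      elim: n => [|n IHn]; first by rewrite !expr0 mulr1.
      apply: (mulfI (lt0r_neq0 a0)); rewrite exprS [in RHS]exprS.
      have -> : a * (normc (psi 1) * (a^-1 * a^-1 ^+ n)) = normc (psi 1) * a^-1 ^+ n.
        by field; rewrite gt_eqF.
      rewrite -IHn [in RHS]psiE ComplexField.Normc.normcM; congr (_ * _).
      by rewrite /= expr0n/= addr0 sqrtr_sqr gtr0_norm.
    have -> : c ^+ 2 * (a * c ^+ 2)^-1 = a^-1.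
      by field; rewrite !gt_eqF.
    rewrite -mulrA -psin; apply: (one_minus_sqr_normc_le hk (phiN0 _) (phi_le1 _)).
    by rewrite /psi addrC subrK.
  have lna : 0 < ln a by rewrite ln_gt0.
  have lnc : ln c < 0 by rewrite -ln1 ltr_ln// posrE.
  (* This alpha solves c = a^(-1/alpha); it is positive because c < 1 < a, and alpha <= 2 amounts to
     ln(a c^2) <= 0. *)
  exists psi, c, (ln a / - ln c); split; last split.
  + split; last exact: psiE.
    * move=> u; have pkN0 : charfun X u ^+ k != 0 by rewrite expf_neq0.
      have FFu : Filter (nbhs u) := nbhs_filter u.
      have h := @cvgV R[i] _ _ FFu _ _ pkN0 (cvg_exprC (k := k) FFu (cphi u)).
      exact: (@cvgB _ R[i]^o _ _ FFu _ _ _ _ h (@cvg_cst R[i]^o 1 _ _ FFu)).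
    * by rewrite /psi phi0 expr1n invr1 subrr.
  + split; [|by []|].
    * have lnc' : 0 < - ln c by rewrite oppr_gt0.
      rewrite divr_gt0//= ler_pdivrMr//.
      have : ln (a * c ^+ 2) <= 0 by rewrite ln_le0.
      rewrite lnM ?posrE ?exprn_gt0// lnXn//; lra.
    * rewrite /powR gt_eqF// -[LHS](lnK (x := c)) ?posrE//; congr expR.
      by field; rewrite (gt_eqF lna) (lt_eqF lnc).
  + exists (fun u => (charfun X u)^-1); last by move=> u; rewrite div1r invrK.
    have one_psi u : 1 + psi u = charfun X u ^- k by rewrite /psi addrC subrK.
    split.
    * by move=> u; rewrite one_psi invr_eq0 expf_neq0.
    * move=> u; exact: (cvgV (phiN0 u) (cphi u)).
    * by rewrite phi0 invr1.
    * by move=> u; rewrite one_psi exprVn.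
- subst b; apply/(harris_sum_stableP c hnu phi_le1) => u.
  pose D u := harris_radicand a k (charfun X (c * u)).
  have rN0 v : r v != 0.
    by apply: contraTneq (psi1 v) => rv; rewrite -rk rv expr0n gtn_eqF//= eqxx.
  have DN0 v : D v != 0 by exact: (harris_neq0 _ ha (phi_le1 _)).
  have wN0 v : principal_root k (D v) != 0 by exact: principal_root_neq0.
  have cscale v : (c * x @[x --> v] --> (c * v : R))%classic.
    by apply: cvgM; [exact: cvg_cst|exact: cvg_id].
  have cD : continuous (D : R -> R[i]^o).
    move=> v; have FFv : Filter (nbhs v) := nbhs_filter v.
    have h := cvg_exprC (k := k) FFv (continuous_cvg FFv (cphi _) (cscale v)).
    have h2 := @cvgM R[i] _ _ FFv _ _ _ _ (@cvg_cst R[i]^o (a - 1)%:C _ _ FFv) h.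
    exact: (@cvgB _ R[i]^o _ _ FFv _ _ _ _ (@cvg_cst R[i]^o a%:C _ _ FFv) h2).
  (* For phi = 1/r, the stability equation at u says exactly that q(u) = 1. *)
  pose q v := r v / (r (c * v) * principal_root k (D v)).
  have q1 : q u = 1.
    apply: (@continuous_unity_root _ k q hk).
    + move=> v; have ReD : 0 < complex.Re (D v).
        exact: lt_le_trans ltr01 (harris_Re_ge1 _ ha (phi_le1 _)).
      have rwN0 : r (c * v) * principal_root k (D v) != 0 by rewrite mulf_neq0.
      have FFv : Filter (nbhs v) := nbhs_filter v.
      have h1 := continuous_cvg FFv (cr _) (cscale v).
      have h2 := cvg_principal_root (k := k) FFv ReD (cD v).
      have h3 := @cvgV R[i] _ _ FFv _ _ rwN0 (@cvgM R[i] _ _ FFv _ _ _ _ h1 h2).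
      exact: (@cvgM R[i] _ _ FFv _ _ _ _ (cr v) h3).
    + move=> v; rewrite /q expr_div_n exprMn !rk/= principal_rootX//.
      have := psi1 (c * v); have := psi1 v.
      rewrite /D /harris_radicand phiE expr_div_n rk/= expr1n [psi v]psiE.
      rewrite rmorphB rmorph1.
      move: (psi (c * v)) => x ax1 x1.
      (* With x = psi(cv), the radicand is a - (a - 1)/(1 + x) = (1 + ax)/(1 + x), and 1 + ax = 1 +
         psi(v). *)
      rewrite (_ : (1 + x) * _ = 1 + a%:C * x) ?divff//.
      by field.
    (* At 0 the radicand is a - (a - 1) = 1, whose principal root is 1. *)
    + rewrite /q /D /harris_radicand mulr0 phi0 r0 expr1n mulr1 -rmorphB/=.
      by rewrite opprB addrC subrK principal_root1 mulr1 divr1.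
  rewrite -/(D u) !phiE (divr1_eq q1).
  by rewrite !div1r invfM.
Qed.
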